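(* Let $\Lambda:=\mathsf S_{\mathfrak M}\operatorname{Del}N^{\star}_{\mathfrak H^{+}}\Box^{\ddag}N_{\mathfrak H^{+}}:\mathfrak H\to\mathbf{Gra}$. If $\phi:G\to G'$ is a morphism in $\mathfrak H$, then \begin{itemize} \item $V(\Lambda(G))=E(G)$, \item $E(\Lambda(G))=\{\{e,f\}:\epsilon_G(e)\cap\epsilon_G(f)\ne\emptyset\}$ (with $e,f\in E(G)$), \item $\Lambda(\phi)=E(\phi)$. \end{itemize}
   Context: Juxtaposition of functors denotes composition. $\mathcal P$ is the covariant power-set functor, $\mathcal P(f)(A)=\{f(x):x\in A\}$. A set-system hypergraph is a triple $G=(E(G),\epsilon_G,V(G))$ with $E(G),V(G)$ sets and $\epsilon_G:E(G)\to\mathcal P(V(G))$ a function. $\mathfrak H$: set-system hypergraphs, with morphisms $\phi:G\to H$ the pairs of functions $E(\phi):E(G)\to E(H)$, $V(\phi):V(G)\to V(H)$ satisfying $\epsilon_H(E(\phi)(e))=\mathcal P(V(\phi))(\epsilon_G(e))$ for all $e$. $\mathfrak H^{+}$: the same objects, with weak set-system homomorphisms, i.e. pairs $(E^{+}(\phi),V^{+}(\phi))$ of functions satisfying only $\mathcal P(V^{+}(\phi))(\epsilon_G(e))\subseteq\epsilon_H(E^{+}(\phi)(e))$ for all $e$. $N_{\mathfrak H^{+}}:\mathfrak H\to\mathfrak H^{+}$ is the inclusion. $\mathfrak M$: the full subcategory of $\mathfrak H$ of those $G$ with $1\le\operatorname{card}(\epsilon_G(e))\le2$ for every edge $e$.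 $\mathbf{Gra}$: objects $(V(G),E(G))$ with $E(G)\subseteq\mathcal P(V(G))$ and $1\le\operatorname{card}(A)\le2$ for all $A\in E(G)$; morphisms are functions $f:V(G)\to V(G')$ with $\mathcal P(f)(A)\in E(G')$ for all $A\in E(G)$. $\Box^{\ddag}:\mathfrak H^{+}\to\mathfrak H^{+}$ (dual hypergraph): $G^{\ddag}$ has vertex set $E(G)$, edge set $V(G)$, and $\epsilon_{G^{\ddag}}(v)=\{e:v\in\epsilon_G(e)\}$; $\varphi^{\ddag}$ is $E^{+}(\varphi)$ on vertices and $V^{+}(\varphi)$ on edges. $N^{\star}_{\mathfrak H^{+}}:\mathfrak H^{+}\to\mathfrak H$ (right adjoint of $N_{\mathfrak H^{+}}$): $N^{\star}_{\mathfrak H^{+}}(G)$ has vertex set $V(G)$, edge set $\{(e,A)\in E(G)\times\mathcal P(V(G)):A\subseteq\epsilon_G(e)\}$, endpoint map $(e,A)\mapsto A$; on morphisms $V^{+}(\phi)$ on vertices and $(e,A)\mapsto(E^{+}(\phi)(e),\mathcal P(V^{+}(\phi))(A))$ on edges. $\operatorname{Del}:\mathfrak H\to\mathfrak M$: keeps all vertices and exactly the edges $e$ with $1\le\operatorname{card}(\epsilon_G(e))\le 2$, restricting morphisms accordingly. $\mathsf S_{\mathfrak M}:\mathfrak M\to\mathbf{Gra}$: $\mathsf S_{\mathfrak M}(G)=(V(G),\{\epsilon_G(e):e\in E(G)\})$, $\mathsf S_{\mathfrak M}(\phi)=V(\phi)$. *)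

(* Defs.v *)
From mathcomp Require Import all_boot.
From mathcomp Require Import boolp classical_sets functions cardinality.
Set Implicit Arguments.
Unset Strict Implicit.
Unset Printing Implicit Defensive.
Local Open Scope classical_set_scope.
Local Open Scope card_scope.

(* A set of vertices or edges is a type; its power set is [set T], and P(f)(A)
   is [f @` A]. *)

Record category := Category {
  ob :> Type;
  hom : ob -> ob -> Type;
  idm : forall X, hom X X;
  cmp : forall X Y Z, hom Y Z -> hom X Y -> hom X Z;
  cmp1m : forall X Y (f : hom X Y), cmp (idm Y) f = f;
  cmpm1 : forall X Y (f : hom X Y), cmp f (idm X) = f;
  cmpA : forall X Y Z W (h : hom Z W) (g : hom Y Z) (f : hom X Y),
    cmp h (cmp g f) = cmp (cmp h g) f }.

Record functor (C D : category) := Functor {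
  fobj :> C -> D;
  fmap : forall X Y : C, hom X Y -> hom (fobj X) (fobj Y);
  fmap1 : forall X : C, fmap (idm X) = idm (fobj X);
  fmapM : forall (X Y Z : C) (g : hom Y Z) (f : hom X Y),
    fmap (cmp g f) = cmp (fmap g) (fmap f) }.

Section Composition.
Variables (C D K : category) (G : functor D K) (F : functor C D).

Lemma fcomp1 (X : C) : fmap G (fmap F (idm X)) = idm (G (F X)).
Proof. by rewrite !fmap1. Qed.

Lemma fcompM (X Y Z : C) (g : hom Y Z) (f : hom X Y) :
  fmap G (fmap F (cmp g f)) = cmp (fmap G (fmap F g)) (fmap G (fmap F f)).
Proof. by rewrite !fmapM. Qed.

Definition fcomp : functor C K :=
  @Functor C K (fun X => G (F X)) (fun X Y f => fmap G (fmap F f))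
    fcomp1 fcompM.
End Composition.

Notation "G \oF F" := (fcomp G F) (at level 50, left associativity).

Definition full_subcategory (C : category) (P : C -> Prop) : category :=
  @Category {X : C | P X} (fun X Y => hom (sval X) (sval Y))
    (fun X => idm (sval X)) (fun _ _ _ g f => cmp g f)
    (fun _ _ f => cmp1m f) (fun _ _ f => cmpm1 f)
    (fun _ _ _ _ h g f => cmpA h g f).

Record hypergraph := Hypergraph {
  edge : Type;
  vertex : Type;
  ends : edge -> set vertex }.

Record hyp_hom (G H : hypergraph) := HypHom {
  emap : edge G -> edge H;
  vmap : vertex G -> vertex H;
  hyp_homP : forall e, ends (emap e) = vmap @` ends e }.

Record weak_hom (G H : hypergraph) := WeakHom {
  wemap : edge G -> edge H;
  wvmap : vertex G -> vertex H;
  weak_homP : forall e, wvmap @` ends e `<=` ends (wemap e) }.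
Arguments weak_homP {G H} w e.

Lemma hyp_hom_eq (G H : hypergraph) (f g : hyp_hom G H) :
  emap f = emap g -> vmap f = vmap g -> f = g.
Proof.
case: f g => [e v p] [e' v' p'] /= ee vv; case: _ / ee in p' *.
by case: _ / vv in p' *; congr HypHom; exact: Prop_irrelevance.
Qed.

Lemma weak_hom_eq (G H : hypergraph) (f g : weak_hom G H) :
  wemap f = wemap g -> wvmap f = wvmap g -> f = g.
Proof.
case: f g => [e v p] [e' v' p'] /= ee vv; case: _ / ee in p' *.
by case: _ / vv in p' *; congr WeakHom; exact: Prop_irrelevance.
Qed.

Lemma hyp_idP (G : hypergraph) (e : edge G) : ends (id e) = id @` ends e.
Proof. by rewrite image_id. Qed.

Lemma hyp_compP (G H K : hypergraph) (g : hyp_hom H K) (f : hyp_hom G H) e :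
  ends ((emap g \o emap f) e) = (vmap g \o vmap f) @` ends e.
Proof. by rewrite /= !hyp_homP image_comp. Qed.

Lemma weak_idP (G : hypergraph) (e : edge G) : id @` ends e `<=` ends (id e).
Proof. by rewrite image_id. Qed.

Lemma weak_compP (G H K : hypergraph) (g : weak_hom H K) (f : weak_hom G H) e :
  (wvmap g \o wvmap f) @` ends e `<=` ends ((wemap g \o wemap f) e).
Proof.
rewrite -image_comp; apply: subset_trans (weak_homP g _).
exact/image_subset/weak_homP.
Qed.

Definition hyp_id (G : hypergraph) : hyp_hom G G := HypHom (@hyp_idP G).
Definition hyp_comp (G H K : hypergraph) (g : hyp_hom H K) (f : hyp_hom G H) :
  hyp_hom G K := HypHom (hyp_compP g f).
Definition weak_id (G : hypergraph) : weak_hom G G := WeakHom (@weak_idP G).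
Definition weak_comp (G H K : hypergraph) (g : weak_hom H K)
  (f : weak_hom G H) : weak_hom G K := WeakHom (@weak_compP G H K g f).

Lemma hyp_comp1m G H (f : hyp_hom G H) : hyp_comp (hyp_id H) f = f.
Proof. exact: hyp_hom_eq. Qed.
Lemma hyp_compm1 G H (f : hyp_hom G H) : hyp_comp f (hyp_id G) = f.
Proof. exact: hyp_hom_eq. Qed.
Lemma hyp_compA G H K L (h : hyp_hom K L) (g : hyp_hom H K) (f : hyp_hom G H) :
  hyp_comp h (hyp_comp g f) = hyp_comp (hyp_comp h g) f.
Proof. exact: hyp_hom_eq. Qed.

Lemma weak_comp1m G H (f : weak_hom G H) : weak_comp (weak_id H) f = f.
Proof. exact: weak_hom_eq. Qed.
Lemma weak_compm1 G H (f : weak_hom G H) : weak_comp f (weak_id G) = f.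
Proof. exact: weak_hom_eq. Qed.
Lemma weak_compA G H K L (h : weak_hom K L) (g : weak_hom H K)
    (f : weak_hom G H) :
  weak_comp h (weak_comp g f) = weak_comp (weak_comp h g) f.
Proof. exact: weak_hom_eq. Qed.

Definition Hyp : category := Category hyp_comp1m hyp_compm1 hyp_compA.
Definition HypPlus : category := Category weak_comp1m weak_compm1 weak_compA.

Definition card12 (T : Type) (A : set T) : Prop :=
  `I_1 #<= A /\ A #<= `I_2.

Definition is_multigraph (G : hypergraph) : Prop :=
  forall e : edge G, card12 (ends e).

Definition Multigraph : category :=
  @full_subcategory Hyp is_multigraph.

Record graph := Graph {
  gvertex : Type;
  gedge : set (set gvertex);
  gedge_card : forall A, gedge A -> card12 A }.
Arguments gedge : clear implicits.

Record graph_hom (G H : graph) := GraphHom {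
  gmap :> gvertex G -> gvertex H;
  graph_homP : forall A, gedge G A -> gedge H (gmap @` A) }.

Lemma graph_hom_eq (G H : graph) (f g : graph_hom G H) :
  gmap f = gmap g -> f = g.
Proof.
case: f g => [f p] [g q] /= fg; case: _ / fg in q *.
by congr GraphHom; exact: Prop_irrelevance.
Qed.

Lemma graph_idP (G : graph) (A : set (gvertex G)) :
  gedge G A -> gedge G (id @` A).
Proof. by rewrite image_id. Qed.

Lemma graph_compP (G H K : graph) (g : graph_hom H K) (f : graph_hom G H) A :
  gedge G A -> gedge K ((g \o f) @` A).
Proof. by move=> GA; rewrite -image_comp; do 2!apply: graph_homP. Qed.

Definition graph_id (G : graph) : graph_hom G G := GraphHom (@graph_idP G).
Definition graph_comp (G H K : graph) (g : graph_hom H K) (f : graph_hom G H) :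
  graph_hom G K := GraphHom (@graph_compP G H K g f).

Lemma graph_comp1m G H (f : graph_hom G H) : graph_comp (graph_id H) f = f.
Proof. exact: graph_hom_eq. Qed.
Lemma graph_compm1 G H (f : graph_hom G H) : graph_comp f (graph_id G) = f.
Proof. exact: graph_hom_eq. Qed.
Lemma graph_compA G H K L (h : graph_hom K L) (g : graph_hom H K)
    (f : graph_hom G H) :
  graph_comp h (graph_comp g f) = graph_comp (graph_comp h g) f.
Proof. exact: graph_hom_eq. Qed.

Definition Gra : category := Category graph_comp1m graph_compm1 graph_compA.

Lemma incl_homP (G H : hypergraph) (f : hyp_hom G H) e :
  vmap f @` ends e `<=` ends (emap f e).
Proof. by rewrite hyp_homP. Qed.

Definition incl_hom (G H : hypergraph) (f : hyp_hom G H) : weak_hom G H :=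
  WeakHom (@incl_homP G H f).

Lemma incl_hom1 (G : hypergraph) : incl_hom (hyp_id G) = weak_id G.
Proof. exact: weak_hom_eq. Qed.

Lemma incl_homM (G H K : hypergraph) (g : hyp_hom H K) (f : hyp_hom G H) :
  incl_hom (hyp_comp g f) = weak_comp (incl_hom g) (incl_hom f).
Proof. exact: weak_hom_eq. Qed.

Definition Incl : functor Hyp HypPlus :=
  @Functor Hyp HypPlus (fun G => G) incl_hom incl_hom1 incl_homM.

Definition dual (G : hypergraph) : hypergraph :=
  @Hypergraph (vertex G) (edge G) (fun v => [set e | ends e v]).

Lemma dual_homP (G H : hypergraph) (f : weak_hom G H) (v : edge (dual G)) :
  wemap f @` ends v `<=` @ends (dual H) (wvmap f v).
Proof. by move=> _ [e /= ev <-]; apply: (weak_homP f); exists v. Qed.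

Definition dual_hom (G H : hypergraph) (f : weak_hom G H) :
  weak_hom (dual G) (dual H) :=
  @WeakHom (dual G) (dual H) (wvmap f) (wemap f) (@dual_homP G H f).

Lemma dual_hom1 (G : hypergraph) : dual_hom (weak_id G) = weak_id (dual G).
Proof. exact: weak_hom_eq. Qed.

Lemma dual_homM (G H K : hypergraph) (g : weak_hom H K) (f : weak_hom G H) :
  dual_hom (weak_comp g f) = weak_comp (dual_hom g) (dual_hom f).
Proof. exact: weak_hom_eq. Qed.

Definition Dual : functor HypPlus HypPlus :=
  @Functor HypPlus HypPlus dual dual_hom dual_hom1 dual_homM.

Definition nstar (G : hypergraph) : hypergraph :=
  @Hypergraph {p : edge G * set (vertex G) | p.2 `<=` ends p.1} (vertex G)
    (fun p => (sval p).2).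

Lemma nstar_edgeP (G H : hypergraph) (f : weak_hom G H) (p : edge (nstar G)) :
  wvmap f @` (sval p).2 `<=` ends (wemap f (sval p).1).
Proof.
case: p => -[e A] /= Ae; apply: subset_trans (weak_homP f e).
exact: image_subset.
Qed.

Definition nstar_edge (G H : hypergraph) (f : weak_hom G H)
    (p : edge (nstar G)) : edge (nstar H) :=
  exist _ (wemap f (sval p).1, wvmap f @` (sval p).2) (@nstar_edgeP G H f p).

Definition nstar_hom (G H : hypergraph) (f : weak_hom G H) :
  hyp_hom (nstar G) (nstar H) :=
  @HypHom (nstar G) (nstar H) (nstar_edge f) (wvmap f) (fun=> erefl).

Lemma nstar_hom1 (G : hypergraph) : nstar_hom (weak_id G) = hyp_id (nstar G).
Proof.
apply: hyp_hom_eq => //=; apply: funext => -[[e A] Ae].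
by apply: eq_exist => /=; rewrite image_id.
Qed.

Lemma nstar_homM (G H K : hypergraph) (g : weak_hom H K) (f : weak_hom G H) :
  nstar_hom (weak_comp g f) = hyp_comp (nstar_hom g) (nstar_hom f).
Proof.
apply: hyp_hom_eq => //=; apply: funext => -[[e A] Ae].
by apply: eq_exist => /=; rewrite image_comp.
Qed.

Definition NStar : functor HypPlus Hyp :=
  @Functor HypPlus Hyp nstar nstar_hom nstar_hom1 nstar_homM.

Lemma card12_image (T U : Type) (f : T -> U) (A : set T) :
  card12 A -> card12 (f @` A).
Proof.
case=> A1 A2; split; last exact: card_le_trans (card_image_le f A) A2.
have [x Ax] : A !=set0.
  apply/set0P; apply: contraTN A1 => /eqP ->.
  by rewrite card_le0 II1; apply/set0P; exists 0.
have := @card_set1 _ (f x); rewrite card_eq_le => /andP[_ le1].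
apply: card_le_trans le1 _; apply: subset_card_le.
by move=> _ ->; exists x.
Qed.

Definition del_graph (G : hypergraph) : hypergraph :=
  @Hypergraph {e : edge G | card12 (ends e)} (vertex G)
    (fun e => ends (sval e)).

Definition del (G : hypergraph) : Multigraph :=
  exist is_multigraph (del_graph G)
    (fun e : {e : edge G | card12 (ends e)} => svalP e).

Lemma del_edgeP (G H : hypergraph) (f : hyp_hom G H)
    (e : edge (del_graph G)) : card12 (ends (emap f (sval e))).
Proof. by rewrite hyp_homP; exact: card12_image (svalP e). Qed.

Definition del_edge (G H : hypergraph) (f : hyp_hom G H)
    (e : edge (del_graph G)) : edge (del_graph H) :=
  exist _ (emap f (sval e)) (del_edgeP f e).

Lemma del_homP (G H : hypergraph) (f : hyp_hom G H) (e : edge (del_graph G)) :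
  ends (del_edge f e) = vmap f @` ends e.
Proof. exact: (hyp_homP f (sval e)). Qed.

Definition del_hom (G H : hypergraph) (f : hyp_hom G H) :
  hyp_hom (del_graph G) (del_graph H) :=
  @HypHom (del_graph G) (del_graph H) (del_edge f) (vmap f) (del_homP f).

Lemma del_hom1 (G : hypergraph) : del_hom (hyp_id G) = hyp_id (del_graph G).
Proof.
apply: hyp_hom_eq => //=; apply: funext => -[e eP].
exact: eq_exist.
Qed.

Lemma del_homM (G H K : hypergraph) (g : hyp_hom H K) (f : hyp_hom G H) :
  del_hom (hyp_comp g f) = hyp_comp (del_hom g) (del_hom f).
Proof.
apply: hyp_hom_eq => //=; apply: funext => -[e eP].
exact: eq_exist.
Qed.

Definition Del : functor Hyp Multigraph :=
  @Functor Hyp Multigraph del del_hom del_hom1 del_homM.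

Lemma simplify_card (G : Multigraph) (A : set (vertex (sval G))) :
  range (@ends (sval G)) A -> card12 A.
Proof. by move=> [e _ <-]; exact: (svalP G). Qed.

Definition simplify (G : Multigraph) : graph :=
  @Graph (vertex (sval G)) (range (@ends (sval G))) (@simplify_card G).

Lemma simplify_homP (G H : Multigraph) (f : hyp_hom (sval G) (sval H))
    (A : set (vertex (sval G))) :
  range (@ends (sval G)) A -> range (@ends (sval H)) (vmap f @` A).
Proof. by move=> [e _ <-]; exists (emap f e) => //; exact: hyp_homP. Qed.

Definition simplify_hom (G H : Multigraph) (f : hyp_hom (sval G) (sval H)) :
  graph_hom (simplify G) (simplify H) :=
  @GraphHom (simplify G) (simplify H) (vmap f) (@simplify_homP G H f).

Lemma simplify_hom1 (G : Multigraph) :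
  @simplify_hom G G (hyp_id (sval G)) = graph_id (simplify G).
Proof. exact: graph_hom_eq. Qed.

Lemma simplify_homM (G H K : Multigraph) (g : hyp_hom (sval H) (sval K))
    (f : hyp_hom (sval G) (sval H)) :
  @simplify_hom G K (hyp_comp g f)
  = graph_comp (@simplify_hom H K g) (@simplify_hom G H f).
Proof. exact: graph_hom_eq. Qed.

Definition Simplify : functor Multigraph Gra :=
  @Functor Multigraph Gra simplify simplify_hom simplify_hom1 simplify_homM.

(* All object parts are transparent, so [gvertex (Lambda G)] reduces to [edge G]
   and the underlying function of [fmap Lambda f] can be compared directly with
   a function between types of edges. *)
Definition Lambda : functor Hyp Gra :=
  Simplify \oF Del \oF NStar \oF Dual \oF Incl.

(* Main.v *)
Require Import Defs.
From mathcomp Require Import all_boot.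
From mathcomp Require Import boolp classical_sets functions cardinality.
Local Open Scope classical_set_scope.

(** [Dual] makes each vertex [v] of [G] an edge, whose ends are the edges of [G] through [v];
    [NStar] adds all its subsets and [Del] keeps those of size one or two. By [card12P] these are
    the sets [[set e; f]] with [v] in both [ends e] and [ends f]. *)

Lemma II2 : `I_2 = [set 0; 1].
Proof. by rewrite IIS II1. Qed.

(** The case [x = y] gives the singletons. *)
Lemma card12P (T : Type) (A : set T) :
  card12 A <-> exists x y, A = [set x; y].
Proof.
split=> [[A_ge1 /pfcard_geP[A0|]]|[x [y ->]]].
- by move: A_ge1; rewrite A0 card_le0 => /eqP/IIn_eq0.
(* A nonempty set of size at most two is an image of [I_2]. *)
- case/surjfunPex=> f ->; exists (f 0), (f 1).
  by rewrite II2 image_setU !image_set1.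
have -> : [set x; y] = (fun n => if n is 0 then x else y) @` `I_2.
  by rewrite II2 image_setU !image_set1.
by apply: card12_image; split; rewrite card_le_II.
Qed.

Theorem lemma5p4 (G G' : Hyp) (phi : hom G G') :
  [/\ gvertex (Lambda G) = edge G,
      gedge (Lambda G) =
        [set A : set (edge G) |
           exists e f : edge G, ends e `&` ends f !=set0 /\ A = [set e; f]]
    & gmap (fmap Lambda phi) = emap phi].
Proof.
(* Vertices and morphisms agree by computation. *)
split=> //; apply/seteqP; split=> A.
  case=> -[[[v B] /= Bv] B12] _ <- /=.
  have /card12P[e [f Bef]] := B12; exists e, f; split=> //; exists v.
  by split; apply: Bv; rewrite /= Bef; [left|right].
case=> e [f [[v [ev fv]] Aef]].
(* The common vertex [v] yields the edge [(v, A)] of [NStar], which survives [Del]. *)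
have Av : A `<=` @ends (dual G) v by rewrite Aef => _ [->|->].
have A12 : card12 A by apply/card12P; exists e, f.
by exists (exist _ (exist _ (v, A) Av) A12).
Qed.
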